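(* Let $t$ be a positive integer and let $G$ be a connected simple graph of order $n\geq 5t+2$ with minimum degree $\delta(G)\geq t$. If $\lambda(G)\geq \lambda\big(K_t\vee(K_{n-2t}\cup tK_1)\big)$, then $G$ has a spanning tree with leaf distance at least four.
   Context: $\lambda(G)$ denotes the largest eigenvalue of the adjacency matrix $A(G)$. $K_m$ is the complete graph on $m$ vertices, $tK_1$ is $t$ isolated vertices, $\cup$ is disjoint union, and $G_1\vee G_2$ is the join (disjoint union plus all edges between $V(G_1)$ and $V(G_2)$). The leaf distance of a tree is the minimum distance in the tree between two distinct leaves (vertices of degree one). *)

(* Defs.v *)
From HB Require Import structures.
From mathcomp Require Import all_boot all_order all_algebra.
From mathcomp Require Import classical_sets reals.
From mathcomp Require polyrcf complex.

Set Implicit Arguments.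
Unset Strict Implicit.
Unset Printing Implicit Defensive.

Import Order.TTheory GRing.Theory Num.Theory.

Record sgraph (T : finType) := SGraph {
  adj :> rel T;
  adj_sym : symmetric adj;
  adj_irrefl : irreflexive adj }.

Section Constructions.

Lemma complete_sym m : symmetric (fun i j : 'I_m => i != j).
Proof. by move=> i j; rewrite eq_sym. Qed.

Lemma complete_irrefl m : irreflexive (fun i j : 'I_m => i != j).
Proof. by move=> i; rewrite eqxx. Qed.

Definition complete (m : nat) : sgraph 'I_m :=
  SGraph (@complete_sym m) (@complete_irrefl m).

Lemma edgeless_sym t : symmetric (fun _ _ : 'I_t => false).
Proof. by []. Qed.

Lemma edgeless_irrefl t : irreflexive (fun _ _ : 'I_t => false).
Proof. by []. Qed.

Definition edgeless (t : nat) : sgraph 'I_t :=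
  SGraph (@edgeless_sym t) (@edgeless_irrefl t).

Variables (T1 T2 : finType) (G1 : sgraph T1) (G2 : sgraph T2).

(* [b] tells whether vertices on different sides are adjacent. *)
Definition sum_rel (b : bool) (u v : T1 + T2) : bool :=
  match u, v with
  | inl x, inl y => G1 x y
  | inr x, inr y => G2 x y
  | _, _ => b
  end.

Lemma sum_rel_sym b : symmetric (sum_rel b).
Proof. by move=> [x|x] [y|y] //=; rewrite adj_sym. Qed.

Lemma sum_rel_irrefl b : irreflexive (sum_rel b).
Proof. by move=> [x|x] /=; rewrite adj_irrefl. Qed.

Definition disjoint_union : sgraph (T1 + T2)%type :=
  SGraph (sum_rel_sym false) (sum_rel_irrefl false).

Definition join : sgraph (T1 + T2)%type :=
  SGraph (sum_rel_sym true) (sum_rel_irrefl true).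

End Constructions.

Section Invariants.

Variables (T : finType) (G : sgraph T).

Definition degree (x : T) : nat := #|[set y | G x y]|.

(* Every degree is smaller than #|T|, so the default value #|T| matters only
   when T is empty. *)
Definition min_degree : nat := \big[minn/#|T|]_(x : T) degree x.

Definition connected : Prop := 0 < #|T| /\ forall x y : T, connect G x y.

(* [ucycle] accepts x, y, x as the cycle [:: x; y], hence the bound on the
   length. *)
Definition acyclic : Prop := forall c : seq T, 2 < size c -> ~ ucycle G c.

Definition is_tree : Prop := connected /\ acyclic.

Definition leaf (x : T) : bool := degree x == 1.

(* Distances between connected vertices are smaller than #|T|; the value #|T|
   plays the role of an infinite distance. *)
Definition dist (x y : T) : nat :=
  \big[minn/#|T|]_(k < #|T| | [exists p : k.-tuple T,
                                 path G x p && (last x p == y)]) k.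

(* A tree with at least two vertices has at least two leaves, so the default
   value #|T| is then irrelevant. *)
Definition leaf_distance : nat :=
  \big[minn/#|T|]_(p : T * T | [&& leaf p.1, leaf p.2 & p.1 != p.2])
     dist p.1 p.2.

End Invariants.

Definition is_spanning_tree (T : finType) (S G : sgraph T) : Prop :=
  subrel S G /\ is_tree S.

Local Open Scope ring_scope.

Definition adj_mx (R : nzRingType) (T : finType) (G : sgraph T) :
    'M[R]_#|T| :=
  \matrix_(i, j) (G (enum_val i) (enum_val j))%:R.

(* The supremum is a maximum: see [lambdaP]. *)
Definition lambda (R : realType) (T : finType) (G : sgraph T) : R :=
  sup [set a : R | eigenvalue (adj_mx R G) a]%classic.

Section Lambda.
Import polyrcf complex.
Local Open Scope complex_scope.

Lemma sym_mx_eigenvalue (R : rcfType) (n : nat) (A : 'M[R]_n) :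
  (0 < n)%N -> A^T = A -> exists a, eigenvalue A a.
Proof.
move=> n0 AT.
pose f := real_complex R.
have sz : size (char_poly (map_mx f A)) != 1%N.
  by rewrite size_char_poly; case: n n0 {A AT}.
have /closed_rootP[z] := sz.
rewrite -eigenvalue_root_char => /eigenvalueP[v vA vn0].
pose c := map_mx (@conjc R).
have cA : c _ _ (map_mx f A) = map_mx f A.
  by apply/matrixP=> i j; rewrite !mxE /= oppr0.
have vA' : (map_mx f A) *m (c _ _ v)^T = z^* *: (c _ _ v)^T.
  have -> : map_mx f A = (map_mx f A)^T by rewrite map_trmx AT.
  by rewrite -trmx_mul -{1}cA /c -map_mxM vA map_mxZ linearZ.
have E : (z - z^*) *: (v *m (c _ _ v)^T) = 0.
  rewrite scalerBl scalemxAl -vA -mulmxA vA' -scalemxAr.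
  by rewrite subrr.
have N : (v *m (c _ _ v)^T) 0 0 != 0.
  rewrite mxE; apply: contra vn0 => /eqP s0.
  have P i : true -> 0 <= v 0 i * (c _ _ v)^T i 0.
    by move=> _; rewrite !mxE mulcJ_ge0.
  apply/eqP/rowP=> i; rewrite mxE.
  have /(_ i isT) := psumr_eq0P P s0.
  by rewrite !mxE => /eqP; rewrite mulf_eq0 conjc_eq0 orbb => /eqP.
have zc : z = z^*.
  move/matrixP/(_ 0 0): E; rewrite !mxE => /eqP; rewrite mulf_eq0.
  rewrite mxE in N; rewrite (negbTE N) orbF subr_eq0 => /eqP //.
exists (complex.Re z).
have zE : z = f (complex.Re z).
  by case: z zc {vA vA' E} => a b [] /eqP;
  rewrite -addr_eq0 -mulr2n mulrn_eq0 => /eqP->.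
rewrite eigenvalue_root_char -(fmorph_root f) map_char_poly.
rewrite -eigenvalue_root_char; apply/eigenvalueP; exists v => //.
by rewrite vA {1}zE.
Qed.

Lemma lambdaP (R : realType) (T : finType) (G : sgraph T) :
  (0 < #|T|)%N ->
  eigenvalue (adj_mx R G) (lambda R G) /\
  forall a, eigenvalue (adj_mx R G) a -> a <= lambda R G.
Proof.
move=> T0; set A := adj_mx R G.
have AT : A^T = A by apply/matrixP=> i j; rewrite !mxE adj_sym.
have [a0 Aa0] := sym_mx_eigenvalue T0 AT.
have [m Am mM] : exists2 m, eigenvalue A m &
    forall a, eigenvalue A a -> a <= m.
  have p0 : char_poly A != 0 by rewrite monic_neq0 ?char_poly_monic.
  have memE a : eigenvalue A a = (a \in rootsR (char_poly A)).
    by rewrite eigenvalue_root_char -(roots_on_rootsR p0).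
  rewrite memE in Aa0.
  have [m ms mM] : exists2 m, m \in rootsR (char_poly A) &
      forall a, a \in rootsR (char_poly A) -> a <= m.
    elim: (rootsR _) a0 Aa0 => // x s IH _ _.
    case: s IH => [|y s] IH.
      by exists x => [|a]; rewrite ?mem_head // inE => /eqP->.
    have [m ms mM] := IH y (mem_head _ _).
    exists (Num.max x m) => [|a].
      by rewrite inE; case: leP; rewrite ?ms ?orbT ?eqxx.
    by rewrite inE le_max => /predU1P[->|/mM->]; rewrite ?lexx ?orbT.
  by exists m => [|a]; rewrite memE // => /mM.
have -> : lambda R G = m.
  apply/eqP; rewrite eq_le; apply/andP; split.
    by apply: ge_sup; [exists m | move=> a /mM].
  by apply: ub_le_sup => //; exists m => a /mM.
by [].
Qed.

End Lambda.

(* Main.v *)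
Require Import Defs.
From mathcomp Require Import all_boot all_order all_algebra.
From mathcomp Require Import reals.
From mathcomp Require Import boolp ring lra zify.

(* G even has a Hamiltonian path, whose only two leaves are at distance n - 1.
   Otherwise Chvatal's argument, applied to an edge-maximal non-traceable
   supergraph of G, gives t <= s <= (n - 2) / 2 and a set I of s + 1 vertices
   of degree at most s in G.  Let rho >= n - t - 1 be a root of the
   characteristic cubic of the equitable partition of
   K_t v (K_(n-2t) u t K_1), so that rho <= lambda(G).  A positive weight w
   with A(G) w < rho w pointwise shows lambda(G) < rho: w is 1 on I, and off I
   it is affine in the number of neighbours in I, which keeps the estimate
   sharp although the edges leaving I are distributed arbitrarily. *)

Set Implicit Arguments.
Unset Strict Implicit.
Unset Printing Implicit Defensive.

Import Order.TTheory GRing.Theory Num.Theory.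

(** * Hamiltonian paths, and preliminaries on sequences and minima *)

Definition traceable (T : finType) (e : rel T) : Prop :=
  exists s : seq T, [/\ uniq s, size s = #|T| & sorted e s].

Lemma mem_uniq_full (T : finType) (s : seq T) (x : T) :
  uniq s -> size s = #|T| -> x \in s.
Proof.
move=> s_uniq s_size; have sub_s : {subset s <= enum T}.
  by move=> y; rewrite mem_enum.
have [|_ ->] := uniq_min_size s_uniq sub_s; first by rewrite s_size cardE.
by rewrite mem_enum.
Qed.

Lemma sorted_from_splits (T : Type) (e : rel T) (s : seq T) :
  (forall s1 x y s2, s = s1 ++ x :: y :: s2 -> e x y) -> sorted e s.
Proof.
elim: s => // x [//|y s] IH H /=; rewrite (H [::] x y s) //=.
by apply: IH => s1 u v s2 E; apply: (H (x :: s1) u v s2); rewrite E.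
Qed.

(** Each of the [size s] consecutive pairs u, v contributes at most one to [P u] plus [Q v]; only
    [Q] at the head and [P] at the last entry lie outside these pairs. *)
Lemma count_shift (T : Type) (P Q : pred T) (x : T) (s : seq T) :
  path (fun u v => ~~ (P u && Q v)) x s ->
  count P (x :: s) + count Q (x :: s) <= size s + Q x + P (last x s).
Proof.
elim: s x => [|y s IH] x /=; first by rewrite !addn0 addnC.
by case/andP=> /negP xy /IH /=; case: (P x) xy; case: (Q y); case: (Q x) => //=; lia.
Qed.

Lemma leq_bigmin (I : finType) (P : pred I) (F : I -> nat) (m d : nat) :
  m <= d -> (forall i, P i -> m <= F i) -> m <= \big[minn/d]_(i | P i) F i.
Proof.
by move=> md mF; elim/big_ind: _ => // x y mx my; rewrite leq_min mx.
Qed.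

Lemma min_degree_le (T : finType) (G : sgraph T) (x : T) : min_degree G <= degree G x.
Proof.
rewrite /min_degree; have := mem_index_enum x.
elim: (index_enum T) => // y r IH; rewrite inE big_cons => /predU1P[->|/IH].
  exact: geq_minl.
exact/leq_trans/geq_minr.
Qed.

(** * Ore's degree-sum argument for Hamiltonian paths *)

Section Ore.
Variables (T : finType) (e : rel T).
Hypotheses (e_sym : symmetric e) (e_irr : irreflexive e).

Let sorted_rev (s : seq T) : sorted e (rev s) = sorted e s.
Proof. by rewrite rev_sorted; apply: eq_sorted => x y; rewrite e_sym. Qed.

Let sorted_link (s1 s2 : seq T) (x y : T) :
  sorted e (s1 ++ x :: y :: s2) =
  [&& sorted e (rcons s1 x), e x y & sorted e (y :: s2)].
Proof.
by rewrite -cat_rcons; case: s1 => [|z s1] //=; rewrite cat_path last_rcons.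
Qed.

(* If x ~ a and y ~ b for consecutive a, b in s1 x, then reversing the segment
   from b to x gives the Hamiltonian path ... a x ... b y ... *)
Let count_left (s1 s2 : seq T) (x y : T) :
    ~ traceable e -> uniq (s1 ++ x :: y :: s2) ->
    size (s1 ++ x :: y :: s2) = #|T| ->
    sorted e (rcons s1 x) -> sorted e (y :: s2) ->
  count (e x) (rcons s1 x) + count (e y) (rcons s1 x) <= size s1.
Proof.
move=> untr s_uniq s_size s1x ys2.
have contra_perm s' : perm_eq s' (s1 ++ x :: y :: s2) -> sorted e s' -> False.
  move=> s'E s'_sort; apply: untr; exists s'.
  by rewrite (perm_uniq s'E) (perm_size s'E).
have r_sorted : sorted (fun a b => ~~ (e x a && e y b)) (rcons s1 x).
  apply: sorted_from_splits => l1 a b l2 E; apply/negP => /andP[xa yb].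
  have bE := lastI b l2; set c := belast b l2 in bE.
  have [s1E xE] : s1 = rcons l1 a ++ c /\ x = last b l2.
    by apply/pair_equal_spec/rcons_inj; rewrite rcons_cat -bE cat_rcons.
  rewrite -xE in bE.
  have revE : x :: rev c = rcons (rev l2) b by rewrite -rev_rcons -bE rev_cons.
  have tourE : l1 ++ a :: (x :: rev c) ++ y :: s2 =
    (rcons l1 a ++ rcons (rev l2) b) ++ y :: s2.
    by rewrite -revE cat_rcons /= -catA.
  apply: (contra_perm (l1 ++ a :: (x :: rev c) ++ y :: s2)).
    rewrite tourE -[s1 ++ _]cat_rcons perm_cat2r s1E rcons_cat -bE perm_cat2l.
    by rewrite -rev_cons perm_rev.
  move: s1x; rewrite E sorted_link => /and3P[l1a _ bl2].
  rewrite cat_cons sorted_link l1a e_sym xa -cat_cons revE cat_rcons.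
  by rewrite sorted_link (e_sym b) yb ys2 -rev_cons sorted_rev bl2.
case E : (rcons s1 x) => [|a l]; first by case: (s1) E.
have szl : size l = size s1 by apply/succn_inj; rewrite -[RHS](size_rcons s1 x) E.
rewrite E in r_sorted; apply: leq_trans (count_shift r_sorted) _.
have -> : last a l = x by rewrite -(last_rcons a s1 x) E.
(* Both boundary terms of [count_shift] vanish: [x] is not its own neighbour, and if [y] were
   adjacent to the first vertex [a], reversing the whole left part would give a Hamiltonian path. *)
rewrite e_irr addn0 szl; case ya : (e y a); last by rewrite addn0.
case: (contra_perm (rev (rcons s1 x) ++ y :: s2)).
  by rewrite -[s1 ++ _]cat_rcons perm_cat2r perm_rev.
rewrite E rev_cons cat_rcons sorted_link -rev_cons -E sorted_rev s1x ys2.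
by rewrite e_sym ya.
Qed.

(** [count_left], applied to the sequence and to its reversal, bounds the contributions of the two
    parts by [size s1] and [size s2], whose sum is [#|T| - 2]. *)
Let degree_sum_split (s1 s2 : seq T) (x y : T) :
    ~ traceable e -> uniq (s1 ++ x :: y :: s2) ->
    size (s1 ++ x :: y :: s2) = #|T| ->
    sorted e (rcons s1 x) -> sorted e (y :: s2) ->
  #|[set z | e x z]| + #|[set z | e y z]| <= #|T| - 2.
Proof.
move=> untr s_uniq s_size s1x ys2.
set s := s1 ++ _ in s_uniq s_size *.
have card_count (P : pred T) : #|[set z | P z]| = count P s.
  rewrite -size_filter -(card_uniqP (filter_uniq P s_uniq)).
  by apply: eq_card => z; rewrite inE mem_filter mem_uniq_full // andbT.
rewrite !card_count -s_size /s -cat_rcons !count_cat size_cat size_rcons.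
have := count_left untr s_uniq s_size s1x ys2.
have revE : rev s2 ++ y :: x :: rev s1 = rev s.
  by rewrite /s rev_cat !rev_cons !cat_rcons.
have := @count_left (rev s2) (rev s1) y x untr.
rewrite revE rev_uniq size_rev -!rev_cons -!rev_rcons !sorted_rev.
move=> /(_ s_uniq s_size ys2 s1x); rewrite !count_rev size_rev.
rewrite /=; lia.
Qed.

(** A Hamiltonian path of the enlarged relation must use the new edge; cutting it there leaves two
    paths of [e], as in [degree_sum_split]. *)
Lemma ore_degree_sum (u v : T) :
  ~ traceable e ->
  traceable (fun x y => [|| e x y, (x == u) && (y == v) | (x == v) && (y == u)]) ->
  #|[set y | e u y]| + #|[set y | e v y]| <= #|T| - 2.
Proof.
set e' := fun x y => _.
move=> untr [s [s_uniq s_size s_sort]].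
have main s1 s2 x y : s = s1 ++ x :: y :: s2 -> (x, y) = (u, v) \/ (x, y) = (v, u) ->
    #|[set z | e x z]| + #|[set z | e y z]| <= #|T| - 2.
  move=> sE xy; move: s_uniq s_size s_sort; rewrite sE => U S.
  (* Neither half contains both ends of the new edge, so its steps are already edges of [e]. *)
  have e'E a b : (a != x) && (b != x) || (a != y) && (b != y) -> e' a b -> e a b.
    rewrite /e'; case: xy => -[-> ->]; case: (a == u); case: (a == v);
      by case: (b == u); case: (b == v); rewrite /= ?orbF.
  move: (U); rewrite -cat_rcons cat_uniq => /and3P[_ /hasPn disj _].
  move=> /cat_sorted2[s1x ys2].
  apply: (@degree_sum_split s1 s2) => //.
    apply: (sub_in_sorted (P := [pred a | a != y]) _ _ s1x).
      by move=> a b; rewrite !inE => ay b_y; apply: e'E; rewrite ay b_y orbT.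
    by apply/allP=> a aA /=; apply: contraTneq aA => ->; apply: disj; rewrite mem_head.
  apply: (sub_in_sorted (P := [pred a | a != x]) _ _ ys2).
    by move=> a b; rewrite !inE => ax bx; apply: e'E; rewrite ax bx.
  apply/allP=> a aA /=; apply: contraTneq aA => ->.
  by apply/negP=> /disj; rewrite mem_rcons mem_head.
case: (boolP (sorted e s)) => [ss|]; first by case: untr; exists s.
apply: contraR; rewrite -ltnNge => big; apply: sorted_from_splits => s1 x y s2 sE.
have : e' x y by move: s_sort; rewrite sE => /cat_sorted2[_ /andP[]].
case/or3P=> [//|/andP[/eqP xu /eqP yv]|/andP[/eqP xv /eqP yu]].
  by have := main _ _ _ _ sE; rewrite xu yv leqNgt big => /(_ (or_introl erefl)).
have := main _ _ _ _ sE.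
by rewrite xv yu addnC leqNgt big => /(_ (or_intror erefl)).
Qed.

End Ore.

(** * Chvatal's low-degree set in a non-traceable graph *)

Lemma traceable_complete (T : finType) (e : rel T) :
  (forall x y, x != y -> e x y) -> traceable e.
Proof.
move=> e_full; exists (enum T); rewrite enum_uniq -cardE; split=> //.
apply: sorted_from_splits => s1 x y s2 E; apply: e_full.
have := enum_uniq T; rewrite E cat_uniq /= inE => /and4P[_ _].
by case: eqVneq.
Qed.

(** In an edge-maximal non-traceable supergraph with degrees [d], take non-adjacent [u], [v] with
    [d u + d v] maximal and [d u <= d v], and let s be [d u]. Every non-neighbour of [v] then has
    degree at most s, and [d u + d v <= #|T| - 2] provides s + 1 of them. *)
Lemma chvatal_low_degree (T : finType) (G : sgraph T) (t : nat) :
  ~ traceable G -> t <= min_degree G ->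
  exists s (I : {set T}), [/\ t <= s, 2 * s + 2 <= #|T|, #|I| = s.+1 &
    {in I, forall x, degree G x <= s}].
Proof.
move=> untr G_deg.
(* Relations become finite sets of pairs, and traceability a boolean, so that [maxset_exists] yields
   the edge-maximal supergraph. *)
pose er (E : {set T * T}) : rel T := fun x y => (x, y) \in E.
pose tr E := [exists s : #|T|.-tuple T, uniq s && sorted (er E) s].
have trP E : reflect (traceable (er E)) (tr E).
  apply: (iffP existsP) => [[s /andP[? ?]]|[s [? /eqP sT ?]]].
    by exists s; rewrite size_tuple.
  by exists (Tuple sT); apply/andP.
pose Q E := [&& [forall x, forall y, G x y ==> er E x y],
  [forall x, forall y, er E x y == er E y x], [forall x, ~~ er E x x] & ~~ tr E].
have QP E : reflect [/\ subrel G (er E), symmetric (er E), irreflexive (er E)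
                      & ~ traceable (er E)] (Q E).
  apply: (iffP and4P) => [[/'forall_'forall_implyP ? /'forall_'forall_eqP ?
                           /forallP irr /trP ?]|[sub sym irr untrE]].
    by split=> // x; apply/negbTE.
  split=> //; [exact/'forall_'forall_implyP | exact/'forall_'forall_eqP | |].
    by apply/forallP=> x; rewrite irr.
  exact/trP.
pose E0 := [set p : T * T | G p.1 p.2].
have erE0 : er E0 =2 G by move=> x y; rewrite /er inE.
have QE0 : Q E0.
  apply/QP; split=> [x y|x y|x|]; rewrite ?erE0 ?adj_irrefl //.
    by rewrite adj_sym.
  by case=> s [? ?]; rewrite (eq_sorted erE0) => ?; apply: untr; exists s.
have [E /maxsetP[/QP[GE E_sym E_irr E_untr] E_max] _] := maxset_exists QE0.
pose e := er E; pose d x := #|[set y | e x y]|.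
have dG x : degree G x <= d x.
  by apply: subset_leq_card; apply/subsetP=> y; rewrite !inE; exact: GE.
have ore u v : u != v -> ~~ e u v -> d u + d v <= #|T| - 2.
  move=> uv euv; apply: ore_degree_sum => //.
  pose E' := E :|: [set (u, v); (v, u)].
  have e'E : er E' =2 (fun x y => [|| e x y, (x == u) && (y == v) | (x == v) && (y == u)]).
    by move=> x y; rewrite /er !inE !xpair_eqE.
  have [s [? ?]] : traceable (er E').
    apply/trP; apply: contraNT euv => /trP untr'.
    suff E'E : E' = E by rewrite /e -E'E e'E !eqxx orbT.
    apply: E_max; last exact: subsetUl.
    apply/QP; split=> // [x y /GE|x y|x]; rewrite !e'E.
    - by rewrite /e => ->.
    - by rewrite /e E_sym; case: (x == u); case: (x == v);
        case: (y == u); case: (y == v).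
    - rewrite /e E_irr /=; case: (eqVneq x u) => [->|_]; rewrite ?(negPf uv) //=.
      by rewrite andbF.
  by rewrite (eq_sorted e'E); exists s.
pose N (p : T * T) := (p.1 != p.2) && ~~ e p.1 p.2.
have [p0 Np0] : exists p, N p.
  apply/existsP; apply: contra_notT E_untr => /existsPn full.
  apply: traceable_complete => x y xy; have := full (x, y).
  by rewrite /N /= xy negbK.
have [u [v [uv euv duv max_uv]]] : exists u v, [/\ u != v, ~~ e u v, d u <= d v &
    forall x y, x != y -> ~~ e x y -> d x + d y <= d u + d v].
  have [[u v] /andP[/= uv euv] max_uv] := @arg_maxnP _ p0 N (fun p => d p.1 + d p.2) Np0.
  have [le|/ltnW le] := leqP (d u) (d v); [exists u, v | exists v, u]; split=> //.
  - by move=> x y xy exy; apply: (max_uv (x, y)); apply/andP.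
  - by rewrite eq_sym.
  - by rewrite /e E_sym.
  - by move=> x y xy exy; rewrite [leqRHS]addnC; apply: (max_uv (x, y)); apply/andP.
have sum_uv := ore _ _ uv euv.
have T2 : 1 < #|T| by apply/card_gt1P; exists u, v.
pose J := [set w | (w != v) && ~~ e v w].
have cardJ : #|J| + d v + 1 = #|T|.
  rewrite -(cardsC [set y | e v y]) (_ : ~: _ = v |: J).
    by rewrite cardsU1 inE eqxx /= /d; lia.
  by apply/setP=> w; rewrite !inE; case: eqVneq => //= ->; rewrite /e E_irr.
have /card_geqP[l [l_uniq l_size lJ]] : d u < #|J| by lia.
exists (d u), [set x in l]; split.
- exact: leq_trans G_deg (leq_trans (min_degree_le G u) (dG u)).
- lia.
- by rewrite cardsE (card_uniqP l_uniq).
move=> x; rewrite inE => /lJ; rewrite inE => /andP[xv evx].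
apply: leq_trans (dG x) _; have := max_uv v x; rewrite eq_sym => /(_ xv evx); lia.
Qed.

(** * A Hamiltonian path as a spanning tree *)

Section PathTree.
Variables (T : finType) (s : seq T).
Hypotheses (s_uniq : uniq s) (s_size : size s = #|T|).

Definition path_rel : rel T := fun x y =>
  ((index x s).+1 == index y s) || ((index y s).+1 == index x s).

Lemma path_rel_sym : symmetric path_rel.
Proof. by move=> x y; rewrite /path_rel orbC. Qed.

Lemma path_rel_irrefl : irreflexive path_rel.
Proof. by move=> x; rewrite /path_rel orbb eqn_leq ltnn. Qed.

Definition path_graph : sgraph T := SGraph path_rel_sym path_rel_irrefl.

Let mem_s x : x \in s.
Proof. exact: mem_uniq_full. Qed.

Let pos_inj : injective (index^~ s).
Proof. by move=> x y /= E; rewrite -(nth_index x (mem_s x)) E nth_index. Qed.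

Let index_lt x : index x s < #|T|.
Proof. by rewrite -s_size index_mem. Qed.

Let index_onto k : k < #|T| -> exists x, index x s = k.
Proof.
move=> kT; have [x0 _] : exists x : T, x \in T by apply/card_gt0P; exact: leq_ltn_trans kT.
by exists (nth x0 s k); rewrite index_uniq ?s_size.
Qed.

Lemma path_graph_connected : 0 < #|T| -> connected path_graph.
Proof.
move=> T0; split=> //.
have [x0 x0E] := index_onto T0.
have to0 k x : index x s = k -> connect path_graph x0 x.
  elim: k x => [|k IH] x xk; first by rewrite (pos_inj (etrans x0E (esym xk))).
  have [|y yk] := @index_onto k; first by have := index_lt x; lia.
  apply: connect_trans (IH y yk) (connect1 _).
  by rewrite /= /path_rel yk xk eqxx.
have csym : connect_sym path_graph by apply: sym_connect_sym; exact: path_rel_sym.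
by move=> x y; apply: (connect_trans (y := x0)); rewrite ?(csym x); exact: to0.
Qed.

(** Both cyclic neighbours of the vertex of largest position in a cycle have the position just
    before it, so they coincide, which a cycle of length above two excludes. *)
Lemma path_graph_acyclic : acyclic path_graph.
Proof.
move=> c c_size /andP[c_cyc c_uniq].
case: c c_size c_cyc c_uniq => // z0 c0; set c := z0 :: c0 => c_size c_cyc c_uniq.
have [x xc x_max] := @arg_maxnP _ z0 (mem c) (index^~ s) (mem_head _ _).
have [i p cE] := rot_to xc.
have p_size : 1 < size p by move: c_size; rewrite -(size_rot i) cE.
have p_uniq : uniq (x :: p) by rewrite -cE rot_uniq.
have p_cyc : cycle path_graph (x :: p) by rewrite -cE rot_cycle.
have p_max y : y \in p -> index y s <= index x s.
  move=> yp; have yc : y \in c by rewrite -(mem_rot i) cE inE yp orbT.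
  exact: x_max yc.
case: p p_size p_uniq p_cyc p_max {cE} => // y p p_size.
rewrite /= rcons_path => /and3P[xp yp p_uniq] /and3P[xy _ zx] p_max.
suff yz : y = last y p.
  case/lastP: p yz yp p_size {xp p_uniq xy zx p_max} => // p z.
  by rewrite last_rcons => <-; rewrite mem_rcons mem_head.
apply: pos_inj; have := p_max y (mem_head _ _).
have := p_max (last y p) (mem_last _ _); move: xy zx; rewrite /= /path_rel; lia.
Qed.

(** Bounds distances from below: the position changes by one at each step. *)
Lemma path_graph_walk (x : T) (p : seq T) : path path_graph x p ->
  (index x s <= index (last x p) s + size p) &&
  (index (last x p) s <= index x s + size p).
Proof.
elim: p x => [|y p IH] x /=; first by rewrite !addn0 leqnn.
case/andP=> xy /IH; move: xy; rewrite /= /path_rel; lia.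
Qed.

Lemma path_graph_leaf (x : T) : leaf path_graph x ->
  index x s = 0 \/ (index x s).+1 = #|T|.
Proof.
move=> /eqP dx; case: (posnP (index x s)) => [|x0]; first by left.
right; apply/eqP; rewrite eqn_leq index_lt leqNgt; apply/negP => xT.
have [|y yE] := @index_onto (index x s).-1; first by lia.
have [z zE] := index_onto xT.
have : #|[set y; z]| <= degree path_graph x.
  by apply: subset_leq_card; apply/subsetP=> a; rewrite !inE => /orP[]/eqP->;
     rewrite /= /path_rel ?yE ?zE; lia.
by rewrite dx cards2; case: eqVneq => // yz; move: zE; rewrite -yz yE; lia.
Qed.

Lemma path_graph_leaf_distance (k : nat) : k < #|T| -> k <= leaf_distance path_graph.
Proof.
(* Both [leaf_distance] and [dist] are minima with default [#|T|], so each requires [k <= #|T|]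
   separately. *)
move=> kT; apply: leq_bigmin => [|[x y] /= /and3P[lx ly xy]]; first exact: ltnW.
apply: leq_bigmin => [|i /existsP[p /andP[px /eqP lp]]]; first exact: ltnW.
have := path_graph_walk px; rewrite lp size_tuple.
have : index x s != index y s by apply: contra xy => /eqP/pos_inj->.
by case: (path_graph_leaf lx); case: (path_graph_leaf ly); lia.
Qed.

Lemma path_graph_sub (G : sgraph T) : sorted G s -> subrel path_graph G.
Proof.
move=> s_sort.
have succ x y : (index x s).+1 = index y s -> G x y.
  move=> xy; have := index_lt y; rewrite -xy -s_size => lt_s.
  have /(sortedP x)/(_ _ lt_s) := s_sort.
  by rewrite nth_index // xy nth_index.
by move=> x y /= /orP[/eqP/succ //|/eqP/succ]; rewrite adj_sym.
Qed.

End PathTree.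

Lemma traceable_spanning_tree (T : finType) (G : sgraph T) (k : nat) :
  traceable G -> k < #|T| ->
  exists S : sgraph T, is_spanning_tree S G /\ k <= leaf_distance S.
Proof.
case=> s [s_uniq s_size s_sort] kT; exists (path_graph s); split.
  split; first exact: path_graph_sub.
  by split; [apply: path_graph_connected => //; lia | exact: path_graph_acyclic].
exact: path_graph_leaf_distance.
Qed.

(** * The characteristic cubic of the extremal graph *)

Section Spectral.
Local Open Scope ring_scope.

(** Intermediate values: the difference of the two sides is - t^3 at n - t - 1, the spectral radius
    of the subgraph K_(n-t), and t (n (n - 1) - 2 t^2) >= 0 at n - 1. *)
Lemma cubic_root (R : rcfType) (t n : R) : 1 <= t -> 5 * t + 2 <= n ->
  exists2 rho, n - t - 1 <= rho &
    rho * (rho + 1) * (rho + 1 - n + t) = t ^+ 2 * (rho + 1 - n + 2 * t).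
Proof.
move=> t1 tn.
pose p : {poly R} := 'X * ('X + 1) * ('X + (1 - n + t)%:P)
                     - (t ^+ 2)%:P * ('X + (1 - n + 2 * t)%:P).
have pE x : p.[x] = x * (x + 1) * (x + (1 - n + t)) - t ^+ 2 * (x + (1 - n + 2 * t)).
  by rewrite /p !hornerE.
have p_ivt : p.[n - t - 1] <= 0 <= p.[n - 1].
  rewrite !pE; apply/andP; split.
    rewrite [X in _ - X](_ : _ = t ^+ 3); last by ring.
    rewrite [X in X - _](_ : _ = 0); last by ring.
    by rewrite sub0r oppr_le0 exprn_ge0 //; lra.
  have -> : n = 5 * t + 2 + (n - 5 * t - 2) by ring.
  have : 0 <= n - 5 * t - 2 by lra.
  by move: (n - _ - _) => a a0; nra.
have [|x /andP[xl _] /rootP] := poly_ivt _ p_ivt; first by lra.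
rewrite pE => E; exists x => //.
by apply/eqP; rewrite -subr_eq0 -E; apply/eqP; ring.
Qed.

(* Cleared of denominators, this is s * (K + s + 1) < rho * (rho + 1) for the
   constant K = (s^2 + s + 1) / (rho + s + 2 - n) of lambda_lt_low_degree. *)
Lemma cubic_gt (R : realFieldType) (t n s rho : R) :
  1 <= t -> 5 * t + 2 <= n -> t <= s -> 2 * s + 2 <= n -> n - t - 1 <= rho ->
  rho * (rho + 1) * (rho + 1 - n + t) = t ^+ 2 * (rho + 1 - n + 2 * t) ->
  s * (s ^+ 2 + s + 1 + (s + 1) * (rho + s + 2 - n)) <
    rho * (rho + 1) * (rho + s + 2 - n).
Proof.
move=> t1 tn ts sn rho_ge E.
pose a := s - t; pose N := n - t - 1; pose e := rho - N.
have a0 : 0 <= a by rewrite subr_ge0.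
have e0 : 0 <= e by rewrite subr_ge0.
have sE : s = t + a by rewrite /a; ring.
have N_ge : 4 * t + 1 <= N by rewrite /N; lra.
have N_ge' : t + 2 * a + 1 <= N by rewrite /N /a; lra.
(* The last factor is (rho + 1 - n + t) + (a + 1); the cubic replaces the product with its first
   summand by t^2 (t + e). *)
have -> : rho * (rho + 1) * (rho + s + 2 - n) =
    rho * (rho + 1) * (a + 1) + t ^+ 2 * (t + e).
  have -> : t + e = rho + 1 - n + 2 * t by rewrite /e /N; ring.
  by rewrite -E /a; ring.
have -> : rho + s + 2 - n = a + 1 + e by rewrite /e /N /a; ring.
have -> : rho = N + e by rewrite /e; ring.
move: a N e a0 e0 sE N_ge N_ge' {E rho_ge tn sn} => a N e a0 e0 -> NA NB.
(* This is what replacing N by N + e adds to the right side minus the left side; being non-negative,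
   it reduces the claim to e = 0. *)
have Dq : 0 <= e * ((2 * N + 1) * (a + 1) + t ^+ 2 - (t + a) * (t + a + 1)
                    + e * (a + 1)).
  have h : 0 <= (N - (t + 2 * a + 1)) * (a + 1) by apply: mulr_ge0; lra.
  have h' : 0 <= e * (a + 1) by apply: mulr_ge0; lra.
  have h2 : 0 <= a * a by apply: mulr_ge0.
  have h3 : 0 <= t * a by apply: mulr_ge0; lra.
  by apply: mulr_ge0 => //; lra.
have sq x : 0 <= x -> x <= N -> x * (x + 1) * (a + 1) <= N * (N + 1) * (a + 1).
  by move=> x0 xN; apply: ler_wpM2r; [lra | apply: ler_pM; lra].
have ta0 : 0 <= t * a by apply: mulr_ge0; lra.
have tt0 : 1 <= t * t by rewrite -[1]mulr1; apply: ler_pM; lra.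
have aa0 : 0 <= a * a by apply: mulr_ge0.
(* Of the two lower bounds 4t+1 (n >= 5t+2) and t+2a+1 (n >= 2s+2) for N, take
   the larger one; in both cases the leading cubic form in a and t vanishes at
   the crossover a = 3t/2, so the estimate is tight there. *)
have [le_a|/ltW ge_a] := leP (2 * a) (3 * t).
  have := sq (4 * t + 1) ltac:(lra) NA.
  have h1 : 0 <= a * ((3 * t - 2 * a) * (4 * t + a)).
    by do 2?apply: mulr_ge0; lra.
  have h2 : 0 <= a * (7 * t - 3 * a) by apply: mulr_ge0; lra.
  lra.
have := sq (t + 2 * a + 1) ltac:(lra) NB.
have h1 : 0 <= a * ((2 * a - 3 * t) * (a + t)) by do 2?apply: mulr_ge0; lra.
have h2 : 0 <= (a - t) * (a + t) by apply: mulr_ge0; lra.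
lra.
Qed.

(** * Eigenvalue bounds from test vectors *)

(** A Collatz-Wielandt bound: compare the two sides of the eigenvector equation at an index where
    [|v i| / w i] is largest. *)
Lemma eigenvalue_lt (R : realFieldType) (n : nat) (A : 'M[R]_n) (w : 'I_n -> R)
    (rho a : R) :
  (forall i j, 0 <= A i j) -> (forall i, 0 < w i) ->
  (forall j, \sum_i w i * A i j < rho * w j) -> eigenvalue A a -> a < rho.
Proof.
move=> A0 w0 Aw /eigenvalueP[v vA /rV0Pn[i0 vi0]].
pose c i := `|v 0 i| / w i.
have [j _ c_max] := @Order.TotalTheory.arg_maxP _ _ _ i0 xpredT c isT.
have vE i : `|v 0 i| = c i * w i by rewrite divfK // gt_eqF.
have c0 : 0 < c j.
  by apply: lt_le_trans (c_max i0 isT); rewrite divr_gt0 ?normr_gt0.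
rewrite -(ltr_pM2r (mulr_gt0 c0 (w0 j))).
have vj : \sum_i v 0 i * A i j = a * v 0 j.
  by have /rowP/(_ j) := vA; rewrite !mxE.
apply: (@le_lt_trans _ _ (\sum_i c j * (w i * A i j))).
  rewrite -vE; apply: (@le_trans _ _ `|a * v 0 j|).
    by rewrite normrM ler_wpM2r // ler_norm.
  rewrite -vj; apply: le_trans (ler_norm_sum _ _ _) _.
  apply: ler_sum => i _; rewrite normrM (ger0_norm (A0 _ _)) vE -mulrA.
  apply: ler_wpM2r; last exact: c_max.
  by apply: mulr_ge0 => //; exact: ltW.
by rewrite -mulr_sumr mulrCA ltr_pM2l.
Qed.

Section Weights.
Variables (R : realType) (T : finType) (G : sgraph T) (w : T -> R) (rho : R).

Lemma sum_adj_mx (j : 'I_#|T|) :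
  \sum_i w (enum_val i) * adj_mx R G i j = \sum_(y | G (enum_val j) y) w y.
Proof.
rewrite [RHS]big_mkcond (big_enum_val (fun y => if G (enum_val j) y then w y else 0)).
apply: eq_bigr => i _; rewrite mxE adj_sym.
by case: ifP; rewrite ?mulr1 ?mulr0.
Qed.

Lemma lambda_lt : (0 < #|T|)%N -> (forall x, 0 < w x) ->
  (forall x, \sum_(y | G x y) w y < rho * w x) -> lambda R G < rho.
Proof.
move=> T0 w0 Gw; have [ev _] := lambdaP R G T0.
apply: (eigenvalue_lt (w := w \o enum_val) _ _ _ ev) => [i j|i|j] //=.
  by rewrite mxE ler0n.
by rewrite sum_adj_mx.
Qed.

Lemma lambda_ge (x : T) : w x != 0 ->
  (forall x, \sum_(y | G x y) w y = rho * w x) -> rho <= lambda R G.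
Proof.
move=> wx Gw; have T0 : (0 < #|T|)%N by apply/card_gt0P; exists x.
apply: (lambdaP R G T0).2; apply/eigenvalueP.
exists (\row_i w (enum_val i)).
  apply/rowP=> j; rewrite !mxE -Gw -sum_adj_mx.
  by apply: eq_bigr => i _; rewrite mxE.
by apply/rV0Pn; exists (enum_rank x); rewrite mxE enum_rankK.
Qed.

End Weights.

(** Here [m] stands for n - 2t. Of the three eigenvector equations, one per class, those on K_m and
    on t K_1 hold identically, and the one on K_t is the cubic. The lower bound on [rho] gives
    [D >= t]. *)
Lemma lambda_extremal_ge (R : realType) (t m : nat) (rho : R) :
  (0 < t)%N -> m%:R + t%:R - 1 <= rho ->
  rho * (rho + 1) * (rho + 1 - m%:R - t%:R) = t%:R ^+ 2 * (rho + 1 - m%:R) ->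
  rho <= lambda R (join (complete t) (disjoint_union (complete m) (edgeless t))).
Proof.
move=> t0 rho_ge E.
pose D := rho + 1 - m%:R.
have t1 : 1 <= t%:R :> R by rewrite ler1n.
have m0 : 0 <= m%:R :> R by rewrite ler0n.
(* Unnormalised eigenvector of the equitable partition, with D > 0 the common
   denominator. *)
pose w (x : 'I_t + ('I_m + 'I_t)) : R :=
  match x with inl _ => rho * D | inr (inl _) => t%:R * rho
             | inr (inr _) => t%:R * D end.
apply: (@lambda_ge _ _ _ w _ (inr (inr (Ordinal t0)))) => [|x].
  by rewrite /= gt_eqF // /D; apply: mulr_gt0; lra.
have sumK k (i : 'I_k) (c : R) : \sum_(j < k | i != j) c = (k%:R - 1) * c.
  rewrite sumr_const (eq_card (B := predC1 i)); last first.
    by move=> j; rewrite !inE eq_sym.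
  rewrite cardC1 card_ord -[LHS]mulr_natl; case: k i => [[]//|k] _.
  by rewrite -[k.+1%:R]natr1 addrK.
have sumF k (c : R) : \sum_(j < k | false) c = 0 by rewrite big_pred0.
have sumT k (c : R) : \sum_(j < k | true) c = k%:R * c.
  by rewrite sumr_const card_ord mulr_natl.
rewrite big_mkcond /= !big_sumType /= -!big_mkcond /=.
case: x => [i|[i|i]] /=; rewrite ?sumK ?sumT ?sumF.
- move: E; rewrite -/D => E; apply/eqP; rewrite -subr_eq0; apply/eqP.
  have -> : 0 = t%:R ^+ 2 * D - rho * (rho + 1) * (D - t%:R) by rewrite -E /D; ring.
  by rewrite /D; ring.
- by rewrite /D; ring.
by rewrite /D; ring.
Qed.

(** * The weight for a graph with many vertices of low degree *)

Definition nbh_in (T : finType) (G : sgraph T) (I : {set T}) (x : T) : nat :=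
  #|[set y in I | G x y]|.

(** Double counting of the edges leaving [I]. *)
Lemma sum_nbh_in (T : finType) (G : sgraph T) (I : {set T}) (s : nat) :
  {in I, forall x, degree G x <= s}%N ->
  (\sum_(x | x \notin I) nbh_in G I x <= #|I| * s)%N.
Proof.
move=> I_deg; rewrite -sum_nat_const.
apply: (@leq_trans (\sum_(y in I) degree G y)); last exact: leq_sum.
have -> : (\sum_(x | x \notin I) nbh_in G I x =
           \sum_(y in I) \sum_(x | x \notin I) G x y)%N.
  rewrite exchange_big; apply: eq_bigr => x _.
  by rewrite /nbh_in -sum1_card big_mkcond [RHS]big_mkcond; apply: eq_bigr => y _;
     rewrite !inE; case: (y \in I); case: (G x y).
apply: leq_sum => y _; rewrite /degree -sum1_card [leqRHS]big_mkcond [leqLHS]big_mkcond /=.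
by apply: leq_sum => x _; rewrite inE adj_sym; case: ifP; case: (G y x).
Qed.

Lemma lambda_lt_low_degree (R : realType) (T : finType) (G : sgraph T)
    (I : {set T}) (s : nat) (rho : R) :
  #|I| = s.+1 -> {in I, forall x, degree G x <= s}%N ->
  s%:R < rho -> 0 < rho + s%:R + 2 - #|T|%:R ->
  s%:R * (s%:R ^+ 2 + s%:R + 1 + (s%:R + 1) * (rho + s%:R + 2 - #|T|%:R)) <
    rho * (rho + 1) * (rho + s%:R + 2 - #|T|%:R) ->
  lambda R G < rho.
Proof.
move=> cardI I_deg s_lt; set D := rho + _ + _ - _ => D0 rho_gt.
pose sr : R := s%:R; rewrite -/sr in s_lt D D0 rho_gt.
have s0 : 0 <= sr by apply: ler0n.
have T0 : (0 < #|T|)%N.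
  by apply: leq_trans (max_card (mem I)); rewrite cardI.
(* Off I, (A w) x <= d x + sum_(y notin I) w y - w x, and the number of edges
   leaving I is at most s^2 + s; adding 1 makes the sum strictly below K. *)
pose K := (sr ^+ 2 + sr + 1) / D.
have K0 : 0 < K by apply: divr_gt0 => //; have := sqr_ge0 sr; lra.
pose d x : R := (nbh_in G I x)%:R.
have d0 x : 0 <= d x by apply: ler0n.
pose w x : R := if x \in I then 1 else (K + d x) / (rho + 1).
have w0 x : 0 < w x.
  by rewrite /w; case: ifP => // _; apply: divr_gt0; have := d0 x; lra.
apply: (@lambda_lt _ _ _ w) => // x.
have [xI|xI] := boolP (x \in I).
  (* [M] bounds all weights, as [d y <= s + 1]. At most [s] neighbours contribute, so [s * M < rho]
     suffices: this is [s < rho] if [M] is 1, and otherwise the cubic inequality [rho_gt]. *)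
  pose M := Num.max 1 ((K + (sr + 1)) / (rho + 1)).
  have wM y : w y <= M.
    rewrite /w /M; case: ifP => _; rewrite le_max ?lexx //.
    apply/orP; right; rewrite ler_pM2r ?invr_gt0; last by lra.
    rewrite lerD2l /d /sr natr1 ler_nat -cardI /nbh_in.
    by apply: subset_leq_card; apply/subsetP=> z; rewrite inE => /andP[].
  rewrite /w xI mulr1.
  apply: (@le_lt_trans _ _ (\sum_(y | G x y) M)).
    by apply: ler_sum => y _; exact: wM.
  rewrite sumr_const -mulr_natl.
  have M1 : 1 <= M by rewrite le_max lexx.
  apply: (@le_lt_trans _ _ (sr * M)).
    apply: ler_wpM2r; first by lra.
    rewrite ler_nat; apply: leq_trans (I_deg _ xI) => //.
    by rewrite /degree cardsE.
  have [->|->] : M = 1 \/ M = (K + (sr + 1)) / (rho + 1).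
    by rewrite /M; case: leP; [right | left].
    by rewrite mulr1.
  rewrite mulrA ltr_pdivrMr; last by lra.
  rewrite -(ltr_pM2r D0).
  have -> : sr * (K + (sr + 1)) * D = sr * (sr ^+ 2 + sr + 1 + (sr + 1) * D).
    rewrite -mulrA mulrDl; congr (_ * (_ + _)).
    by rewrite /K divfK // gt_eqF.
  exact: rho_gt.
have sumI : \sum_(y | G x y && (y \in I)) w y = d x.
  rewrite (eq_bigr (fun=> 1)); last by move=> y /andP[_ yI]; rewrite /w yI.
  rewrite sumr_const /d /nbh_in; congr (_ *+ _).
  by apply: eq_card => y; rewrite !inE andbC.
(* With [#|T| - s - 1] vertices off [I], the claim amounts to [K * D] exceeding the sum of [d] off
   [I]. *)
have sumC : \sum_(y | y \notin I) w y < K.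
  rewrite (eq_bigr (fun y => (K + d y) / (rho + 1))); last first.
    by move=> y yI; rewrite /w (negPf yI).
  rewrite -mulr_suml ltr_pdivrMr; last by lra.
  rewrite big_split /= sumr_const -natr_sum.
  rewrite -[K *+ _]mulr_natr (_ : #|_|%:R = #|T|%:R - (sr + 1)); last first.
    by rewrite -(cardC I) cardI natrD -natr1 addrAC subrr add0r.
  have : ((\sum_(y | y \notin I) nbh_in G I y)%:R : R) <= (sr + 1) * sr.
    by rewrite /sr natr1 -natrM ler_nat -cardI; exact: sum_nbh_in.
  have : K * D = sr ^+ 2 + sr + 1 by rewrite /K divfK // gt_eqF.
  by rewrite /D; lra.
rewrite (bigID (mem I)) /= sumI.
rewrite (bigD1 x) //= in sumC.
have : \sum_(y | G x y && (y \notin I)) w y <= \sum_(y | (y \notin I) && (y != x)) w y.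
  rewrite [leLHS]big_mkcond [leRHS]big_mkcond /=; apply: ler_sum => y _.
  have [->|_] := eqVneq y x; first by rewrite adj_irrefl !andbF.
  by case: (G x y); case: (y \in I) => //=; rewrite ltW.
(* Hence the denominator in [w]: the bound [d x + K - w x] is exactly [rho * w x]. *)
have : (rho + 1) * w x = K + d x.
  by rewrite /w (negPf xI) mulrC divfK // gt_eqF //; lra.
lra.
Qed.

End Spectral.

Theorem theorem1p8 (R : realType) (t n : nat) (T : finType) (G : sgraph T)
    (t_gt0 : 0 < t) (cardT : #|T| = n) (n_ge : 5 * t + 2 <= n)
    (G_conn : connected G) (G_deg : t <= min_degree G)
    (G_lambda : (lambda R (join (complete t)
                   (disjoint_union (complete (n - 2 * t)) (edgeless t)))
                 <= lambda R G)%R) :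
  exists S : sgraph T, is_spanning_tree S G /\ 4 <= leaf_distance S.
Proof.
apply: traceable_spanning_tree; last by rewrite cardT; lia.
case: (pselect (traceable G)) => // untr.
have [s [I [ts sn cardI I_deg]]] := chvatal_low_degree untr G_deg.
rewrite cardT in sn.
have t1 : (1 <= t%:R :> R)%R by rewrite ler1n.
have tn : (5 * t%:R + 2 <= n%:R :> R)%R by rewrite -natrM -natrD ler_nat.
have tsR : (t%:R <= s%:R :> R)%R by rewrite ler_nat.
have snR : (2 * s%:R + 2 <= n%:R :> R)%R by rewrite -natrM -natrD ler_nat.
have [rho rho_ge rhoE] := cubic_root t1 tn.
have rho_gt := cubic_gt t1 tn tsR snR rho_ge rhoE.
have mR : ((n - 2 * t)%:R = n%:R - 2 * t%:R :> R)%R.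
  by rewrite natrB ?natrM //; lia.
have : (rho <= lambda R G)%R.
  apply: le_trans G_lambda; apply: lambda_extremal_ge => //; rewrite mR; first by lra.
  rewrite [RHS](_ : _ = t%:R ^+ 2 * (rho + 1 - n%:R + 2 * t%:R))%R; last by ring.
  by rewrite -rhoE; ring.
(* The side conditions s < rho and rho + s + 2 - n > 0 follow from t <= s, 2s + 2 <= n and rho >= n
   - t - 1. *)
rewrite leNgt (@lambda_lt_low_degree _ _ _ _ _ _ cardI I_deg) ?cardT //; lra.
Qed.
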